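(* Let $R$ and $S$ be commutative noetherian rings, let $C$ be a semidualizing $R$-module, let $M$ be an $R$-module, and let $R\to S$ be a flat ring homomorphism. If $L$ is a proper $\mathcal{P}_C$-resolution of $M$ over $R$, then $S\otimes_R L$ is a proper $\mathcal{P}_{S\otimes_R C}$-resolution of $S\otimes_R M$ over $S$.
   Context: A finitely generated module $C$ over a commutative noetherian ring $R$ is semidualizing if the homothety map $R\to\operatorname{Hom}_R(C,C)$ is an isomorphism and $\operatorname{Ext}^i_R(C,C)=0$ for all $i\geq 1$. If $R\to S$ is flat, then $S\otimes_R C$ is a semidualizing $S$-module. $\mathcal{P}_C(R)$ is the class of $R$-modules isomorphic to $P\otimes_R C$ with $P$ a projective $R$-module. A proper $\mathcal{P}_C$-resolution of $M$ is a complex $X=(\cdots\to X_1\to X_0\to 0)$ with each $X_i\in\mathcal{P}_C(R)$ together with an augmentation $X_0\to M$ such that $X^+=(\cdots\to X_1\to X_0\to M\to 0)$ is a complex (not necessarily exact) and $\operatorname{Hom}_R(Y,X^+)$ is exact for all $Y\in\mathcal{P}_C(R)$; similarly over $S$ with $S\otimes_R C$. The complex $S\otimes_R L$ is augmented by applying $S\otimes_R-$ to the augmentation of $L$. *)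

(* Defs.v *)
From HB Require Import structures.
From mathcomp Require Import all_boot all_algebra boolp.

Set Implicit Arguments.
Unset Strict Implicit.
Unset Printing Implicit Defensive.

Import GRing.Theory.
Local Open Scope ring_scope.
Local Open Scope quotient_scope.

(* Rings are comPzRingType, so that the zero ring is allowed.  Ideals and
   submodules are Prop-valued predicates. *)

Section FinitelyGenerated.
Variables (R : comPzRingType) (M : lmodType R).

Definition is_submodule (I : M -> Prop) : Prop :=
  [/\ I 0, (forall x y, I x -> I y -> I (x + y))
    & (forall (r : R) x, I x -> I (r *: x))].

Definition submodule_fg (I : M -> Prop) : Prop :=
  exists (n : nat) (g : 'I_n -> M),
    forall x, I x <-> exists a : 'I_n -> R, x = \sum_(i < n) a i *: g i.

Definition finitely_generated : Prop := submodule_fg (fun=> True).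

End FinitelyGenerated.

Definition noetherian (R : comPzRingType) : Prop :=
  forall I : R^o -> Prop, is_submodule I -> submodule_fg I.

Definition hom (R : comPzRingType) (M N : lmodType R) : Type :=
  {linear M -> N}.

Lemma homP (R : comPzRingType) (M N : lmodType R) (f g : hom M N) :
  (forall x, f x = g x) -> f = g.
Proof.
case: f => f [a s]; case: g => g [a' s'] /= /funext fg.
by move: a s a' s'; rewrite fg => -[a0] [s0] [a1] [s1];
  rewrite (Prop_irrelevance a0 a1) (Prop_irrelevance s0 s1).
Qed.

HB.instance Definition _ (R : comPzRingType) (M N : lmodType R) :=
  gen_eqMixin (hom M N).
HB.instance Definition _ (R : comPzRingType) (M N : lmodType R) :=
  gen_choiceMixin (hom M N).

Section Hom.
Variables (R : comPzRingType) (M N : lmodType R).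

Definition hom_zero : hom M N := \0 : {linear M -> N}.
Definition hom_opp (f : hom M N) : hom M N := (\- f) : {linear M -> N}.
Definition hom_add (f g : hom M N) : hom M N := (f \+ g) : {linear M -> N}.

Fact hom_addA : associative hom_add.
Proof. by move=> f g h; apply: homP => x /=; rewrite addrA. Qed.
Fact hom_addC : commutative hom_add.
Proof. by move=> f g; apply: homP => x /=; rewrite addrC. Qed.
Fact hom_add0 : left_id hom_zero hom_add.
Proof. by move=> f; apply: homP => x /=; rewrite add0r. Qed.
Fact hom_addN : left_inverse hom_zero hom_opp hom_add.
Proof. by move=> f; apply: homP => x /=; rewrite addNr. Qed.

HB.instance Definition _ :=
  GRing.isZmodule.Build (hom M N) hom_addA hom_addC hom_add0 hom_addN.

Fact scale_fun_linear (r : R) (f : {linear M -> N}) : linear (r \*: f).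
Proof. by move=> a x y /=; rewrite linearP scalerDr !scalerA mulrC. Qed.
HB.instance Definition _ (r : R) (f : {linear M -> N}) :=
  GRing.isLinear.Build R M N *:%R (r \*: f) (scale_fun_linear r f).
Definition hom_scale (r : R) (f : hom M N) : hom M N :=
  (r \*: f) : {linear M -> N}.

Fact hom_scaleA a b f : hom_scale a (hom_scale b f) = hom_scale (a * b) f.
Proof. by apply: homP => x /=; rewrite scalerA. Qed.
Fact hom_scale1 : left_id 1 hom_scale.
Proof. by move=> f; apply: homP => x /=; rewrite scale1r. Qed.
Fact hom_scaleDr : right_distributive hom_scale +%R.
Proof. by move=> a f g; apply: homP => x /=; rewrite scalerDr. Qed.
Fact hom_scaleDl f : {morph hom_scale^~ f : a b / a + b}.
Proof. by move=> a b; apply: homP => x /=; rewrite scalerDl. Qed.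

HB.instance Definition _ := GRing.Zmodule_isLmodule.Build R (hom M N)
  hom_scaleA hom_scale1 hom_scaleDr hom_scaleDl.

End Hom.

Section HomMaps.
Variables (R : comPzRingType).

Definition hom_post (Y M N : lmodType R) (f : {linear M -> N})
  (h : hom Y M) : hom Y N := (f \o h) : {linear Y -> N}.

Definition hom_pre (M N Z : lmodType R) (f : {linear M -> N})
  (h : hom N Z) : hom M Z := (h \o f) : {linear M -> Z}.

Fact hom_post_linear (Y M N : lmodType R) (f : {linear M -> N}) :
  linear (@hom_post Y M N f).
Proof. by move=> a g h; apply: homP => x /=; rewrite linearP. Qed.

Fact hom_pre_linear (M N Z : lmodType R) (f : {linear M -> N}) :
  linear (@hom_pre M N Z f).
Proof. by move=> a g h; apply: homP. Qed.

HB.instance Definition _ (Y M N : lmodType R) (f : {linear M -> N}) :=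
  GRing.isLinear.Build R (hom Y M) (hom Y N)
  *:%R (@hom_post Y M N f) (@hom_post_linear Y M N f).
HB.instance Definition _ (M N Z : lmodType R) (f : {linear M -> N}) :=
  GRing.isLinear.Build R (hom N Z) (hom M Z)
  *:%R (@hom_pre M N Z f) (@hom_pre_linear M N Z f).

Definition homothety (C : lmodType R) (r : R) : hom C C :=
  hom_scale r (idfun : {linear C -> C}).

Fact homothety_linear (C : lmodType R) : linear (homothety C : R^o -> hom C C).
Proof. by move=> a r s; apply: homP => x /=; rewrite scalerDl scalerA. Qed.
HB.instance Definition _ (C : lmodType R) :=
  GRing.isLinear.Build R R^o (hom C C) *:%R (homothety C) (homothety_linear C).

End HomMaps.

(* Sequences ... -> X_2 -> X_1 -> X_0 -> 0, with [chain_diff X n] from X_(n+1)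
   to X_n.  That composites vanish is the separate predicate [is_complex]. *)

Record chain (R : comPzRingType) := Chain {
  chain_obj :> nat -> lmodType R;
  chain_diff : forall n, {linear chain_obj n.+1 -> chain_obj n}
}.

Definition exact_at (T U V : nmodType) (f : T -> U) (g : U -> V) : Prop :=
  forall y, g y = 0 <-> exists x, f x = y.

Section Chains.
Variable R : comPzRingType.

Definition is_complex (X : chain R) : Prop :=
  forall n x, chain_diff X n (chain_diff X n.+1 x) = 0.

(* The degree 0 term is followed by 0, hence the surjectivity. *)
Definition exact_chain (X : chain R) : Prop :=
  (forall y, exists x, chain_diff X 0 x = y) /\
  (forall n, exact_at (chain_diff X n.+1) (chain_diff X n)).

(* X^+, with M in degree 0 and X_n in degree n+1. *)
Definition augment_obj (X : chain R) (M : lmodType R) (n : nat) : lmodType R :=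
  if n is m.+1 then X m else M.

Definition augment (X : chain R) (M : lmodType R) (eps : {linear X 0 -> M}) :
    chain R :=
  @Chain R (augment_obj X M)
    (fun n => match n return
         {linear augment_obj X M n.+1 -> augment_obj X M n} with
       | 0 => eps
       | m.+1 => chain_diff X m
       end).

Definition hom_chain (Y : lmodType R) (X : chain R) : chain R :=
  @Chain R (fun n => hom Y (X n)) (fun n => hom_post (chain_diff X n)).

End Chains.

Section Semidualizing.
Variable R : comPzRingType.

Definition projective (P : lmodType R) : Prop :=
  forall (A B : lmodType R) (g : {linear A -> B}) (h : {linear P -> B}),
    (forall b, exists a, g a = b) ->
    exists k : {linear P -> A}, forall x, g (k x) = h x.

Definition projective_resolution (M : lmodType R) (P : chain R)
    (eps : {linear P 0 -> M}) : Prop :=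
  (forall n, projective (P n)) /\ exact_chain (augment eps).

(* Ext^(n+1)_R(M, N) = 0: the cohomology at Hom(P_(n+1), N) of the complex
   Hom(P, N) vanishes.  As that cohomology does not depend on the projective
   resolution P of M, and as M has one, "for all P" and "for some P" are
   equivalent. *)
Definition ExtS_vanishes (n : nat) (M N : lmodType R) : Prop :=
  forall (P : chain R) (eps : {linear P 0 -> M}), projective_resolution eps ->
    exact_at (@hom_pre R _ _ N (chain_diff P n))
             (@hom_pre R _ _ N (chain_diff P n.+1)).

Definition semidualizing (C : lmodType R) : Prop :=
  [/\ finitely_generated C, bijective (homothety C)
    & forall n, ExtS_vanishes n C C].

End Semidualizing.

(* The tensor product M (x)_R N is the quotient of the monoid of lists of pairs
   (formal sums of pure tensors) by the congruence generated by commutativity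
   and the bilinearity relations.  Lists have no additive inverses, so the
   relation (0, n) = 0 is not a consequence of the others and is included; the
   opposite of m (x) n is (- m) (x) n.  See [tensor_universal]. *)

Section Tensor.
Variables (R : comPzRingType) (M N : lmodType R).

Inductive teq : seq (M * N) -> seq (M * N) -> Prop :=
| teq_refl u : teq u u
| teq_sym u v : teq u v -> teq v u
| teq_trans u v w : teq u v -> teq v w -> teq u w
| teq_cat u u' v v' : teq u u' -> teq v v' -> teq (u ++ v) (u' ++ v')
| teq_catC u v : teq (u ++ v) (v ++ u)
| teq_addl m m' n : teq [:: (m + m', n)] [:: (m, n); (m', n)]
| teq_addr m n n' : teq [:: (m, n + n')] [:: (m, n); (m, n')]
| teq_zero n : teq [:: (0, n)] [::]
| teq_scale r m n : teq [:: (r *: m, n)] [:: (m, r *: n)].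

Definition teqb (u v : seq (M * N)) : bool := `[< teq u v >].

Fact teqb_refl : reflexive teqb.
Proof. by move=> u; apply/asboolP; apply: teq_refl. Qed.
Fact teqb_sym : symmetric teqb.
Proof. by move=> u v; apply/asboolP/asboolP; apply: teq_sym. Qed.
Fact teqb_trans : transitive teqb.
Proof.
by move=> v u w /asboolP uv /asboolP vw; apply/asboolP; apply: teq_trans vw.
Qed.

Definition teq_equiv : equiv_rel (seq (M * N)) :=
  EquivRel teqb teqb_refl teqb_sym teqb_trans.

Definition tensor : Type := {eq_quot teq_equiv}.
HB.instance Definition _ := Choice.on tensor.

Definition tsum (u : seq (M * N)) : tensor := \pi_({eq_quot teq_equiv}) u.
Definition trepr (x : tensor) : seq (M * N) :=
  repr (x : {eq_quot teq_equiv}).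

Lemma treprK x : tsum (trepr x) = x.
Proof. exact: reprK. Qed.

Lemma tsumP u v : tsum u = tsum v <-> teq u v.
Proof.
split=> [/(@eqmodP _ teq_equiv)/asboolP //|uv].
by apply/(@eqmodP _ teq_equiv)/asboolP.
Qed.

Lemma trepr_teq u : teq (trepr (tsum u)) u.
Proof. by apply/tsumP; rewrite treprK. Qed.

Definition tscale_seq (r : R) (u : seq (M * N)) : seq (M * N) :=
  [seq (r *: p.1, p.2) | p <- u].

Lemma teq_tscale r u v : teq u v -> teq (tscale_seq r u) (tscale_seq r v).
Proof.
elim=> {u v} //=.
- by move=> u; apply: teq_refl.
- by move=> u v _; apply: teq_sym.
- by move=> u v w _ uv _; apply: teq_trans uv.
- by move=> u u' v v' _ uu' _ vv'; rewrite /tscale_seq !map_cat; apply: teq_cat.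
- by move=> u v; rewrite /tscale_seq !map_cat; apply: teq_catC.
- by move=> m m' n; rewrite scalerDr; apply: teq_addl.
- by move=> m n n'; apply: teq_addr.
- by move=> n; rewrite scaler0; apply: teq_zero.
- by move=> s m n; rewrite scalerA mulrC -scalerA; apply: teq_scale.
Qed.

Definition tensor_zero : tensor := tsum [::].
Definition tensor_add (x y : tensor) : tensor := tsum (trepr x ++ trepr y).
Definition tensor_scale (r : R) (x : tensor) : tensor :=
  tsum (tscale_seq r (trepr x)).
Definition tensor_opp : tensor -> tensor := tensor_scale (- 1).

Lemma tsum_cat u v : tsum (u ++ v) = tensor_add (tsum u) (tsum v).
Proof.
by apply/tsumP; apply: teq_cat; apply: teq_sym; apply: trepr_teq.
Qed.

Lemma tsum_scale r u : tsum (tscale_seq r u) = tensor_scale r (tsum u).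
Proof. by apply/tsumP; apply: teq_tscale; apply: teq_sym; apply: trepr_teq. Qed.

Fact tensor_addA : associative tensor_add.
Proof.
move=> x y z; rewrite -(treprK x) -(treprK y) -(treprK z).
by rewrite -!tsum_cat catA.
Qed.

Fact tensor_addC : commutative tensor_add.
Proof. by move=> x y; apply/tsumP; apply: teq_catC. Qed.

Fact tensor_add0 : left_id tensor_zero tensor_add.
Proof. by move=> x; rewrite -(treprK x) -tsum_cat. Qed.

Lemma tsum_ind (K : tensor -> Prop) :
  K tensor_zero -> (forall m n x, K x -> K (tensor_add (tsum [:: (m, n)]) x)) ->
  forall x, K x.
Proof.
move=> K0 Kadd x; rewrite -(treprK x); elim: (trepr x) => // -[m n] u IHu.
by rewrite -cat1s tsum_cat; apply: Kadd.
Qed.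

Lemma tensor_addACA : interchange tensor_add tensor_add.
Proof.
move=> x y z t; rewrite -!tensor_addA; congr tensor_add.
by rewrite !tensor_addA (tensor_addC y).
Qed.

Fact tensor_scaleDr : right_distributive tensor_scale tensor_add.
Proof.
move=> r x y; rewrite -(treprK x) -(treprK y) -tsum_cat -!tsum_scale.
by rewrite /tscale_seq map_cat tsum_cat.
Qed.

Fact tensor_scaleDl' x r s :
  tensor_scale (r + s) x = tensor_add (tensor_scale r x) (tensor_scale s x).
Proof.
elim/tsum_ind: x => [|m n x IHx].
  by rewrite -!tsum_scale tensor_add0.
rewrite !tensor_scaleDr IHx tensor_addACA; congr tensor_add.
rewrite -!tsum_scale -tsum_cat /= scalerDl; apply/tsumP; exact: teq_addl.
Qed.

Fact tensor_scaleA a b x :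
  tensor_scale a (tensor_scale b x) = tensor_scale (a * b) x.
Proof.
rewrite -(treprK x) -!tsum_scale /tscale_seq -map_comp; congr tsum.
by apply: eq_map => p /=; rewrite scalerA.
Qed.

Fact tensor_scale1 : left_id 1 tensor_scale.
Proof.
move=> x; rewrite -(treprK x) -tsum_scale; congr tsum.
by rewrite -[RHS]map_id; apply: eq_map => -[m n] /=; rewrite scale1r.
Qed.

Lemma tensor_scale0 x : tensor_scale 0 x = tensor_zero.
Proof.
elim/tsum_ind: x => [|m n x IHx]; first by rewrite -tsum_scale.
rewrite tensor_scaleDr IHx -tsum_scale tensor_addC tensor_add0 /= scale0r.
by apply/tsumP; apply: teq_zero.
Qed.

Fact tensor_addN : left_inverse tensor_zero tensor_opp tensor_add.
Proof.
move=> x; rewrite /tensor_opp -[x in tensor_add _ x]tensor_scale1.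
by rewrite -tensor_scaleDl' addNr tensor_scale0.
Qed.

HB.instance Definition _ := GRing.isZmodule.Build tensor
  tensor_addA tensor_addC tensor_add0 tensor_addN.

Fact tensor_scaleDl x : {morph tensor_scale^~ x : a b / a + b}.
Proof. by move=> a b; apply: tensor_scaleDl'. Qed.

HB.instance Definition _ := GRing.Zmodule_isLmodule.Build R tensor
  tensor_scaleA tensor_scale1 tensor_scaleDr tensor_scaleDl.

Definition pure (m : M) (n : N) : tensor := tsum [:: (m, n)].

Lemma pureDl m m' n : pure (m + m') n = pure m n + pure m' n.
Proof. by rewrite /pure -[RHS]tsum_cat; apply/tsumP; apply: teq_addl. Qed.

Lemma pureDr m n n' : pure m (n + n') = pure m n + pure m n'.
Proof. by rewrite /pure -[RHS]tsum_cat; apply/tsumP; apply: teq_addr. Qed.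

Lemma pureZl r m n : pure (r *: m) n = r *: pure m n.
Proof. by rewrite /pure -[RHS]tsum_scale. Qed.

Lemma pureZr r m n : pure m (r *: n) = r *: pure m n.
Proof.
by rewrite -pureZl /pure; apply/tsumP; apply: teq_sym; apply: teq_scale.
Qed.

Lemma tensor_ind (K : tensor -> Prop) :
  K 0 -> (forall m n x, K x -> K (pure m n + x)) -> forall x, K x.
Proof. exact: tsum_ind. Qed.

Lemma tensor_ext (K : lmodType R) (f g : {linear tensor -> K}) :
  (forall m n, f (pure m n) = g (pure m n)) -> f =1 g.
Proof.
move=> fg x; elim/tensor_ind: x => [|m n x IHx]; first by rewrite !linear0.
by rewrite !linearD IHx fg.
Qed.

End Tensor.

Section TensorLift.
Variables (R : comPzRingType) (M N K : lmodType R) (f : M -> N -> K).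

Definition bilinear_map : Prop :=
  [/\ forall m m' n, f (m + m') n = f m n + f m' n,
      forall m n n', f m (n + n') = f m n + f m n',
      forall r m n, f (r *: m) n = r *: f m n
    & forall r m n, f m (r *: n) = r *: f m n].

Definition tensor_lift (x : tensor M N) : K :=
  \sum_(p <- trepr x) f p.1 p.2.

Hypothesis bf : bilinear_map.

Lemma tensor_lift_tsum u : tensor_lift (tsum u) = \sum_(p <- u) f p.1 p.2.
Proof.
case: bf => fDl fDr fZl fZr.
rewrite /tensor_lift; move: (trepr_teq u); move: (trepr _) => v.
elim=> {u v} //.
- by move=> u v w _ -> _ ->.
- by move=> u u' v v' _ e _ e'; rewrite !big_cat e e'.
- by move=> u v; rewrite !big_cat /= addrC.
- by move=> m m' n; rewrite !big_cons !big_nil /= fDl !addr0.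
- by move=> m n n'; rewrite !big_cons !big_nil /= fDr !addr0.
- by move=> n; rewrite big_cons big_nil /= -(scale0r (0 : M)) fZl scale0r addr0.
- by move=> r m n; rewrite !big_cons !big_nil /= fZl fZr.
Qed.

Lemma tensor_lift_pure m n : tensor_lift (pure m n) = f m n.
Proof. by rewrite tensor_lift_tsum big_cons big_nil addr0. Qed.

Lemma tensor_lift_linear : linear tensor_lift.
Proof.
have [_ _ fZl _] := bf.
move=> r x y; rewrite -(treprK x) -(treprK y).
rewrite -[r *: _]tsum_scale -[_ + _ in LHS]tsum_cat !tensor_lift_tsum big_cat.
by rewrite scaler_sumr big_map /=; under eq_bigr do rewrite fZl.
Qed.

Lemma tensor_universal :
  exists! g : hom (tensor M N) K, forall m n, g (pure m n) = f m n.
Proof.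
pose a := GRing.isLinear.Build R _ _ *:%R tensor_lift tensor_lift_linear.
pose g : {linear tensor M N -> K} := HB.pack tensor_lift a.
exists g; split=> [m n|h hE]; first exact: tensor_lift_pure.
apply: homP; apply: (tensor_ext (f := g)) => m n.
by rewrite hE; apply: tensor_lift_pure.
Qed.

End TensorLift.

Section TensorMap.
Variables (R : comPzRingType) (M M' N N' : lmodType R).
Variables (f : {linear M -> M'}) (g : {linear N -> N'}).

Definition tensor_map : tensor M N -> tensor M' N' :=
  tensor_lift (fun m n => pure (f m) (g n)).

Fact tensor_map_bilinear : bilinear_map (fun m n => pure (f m) (g n)).
Proof.
by split=> *; rewrite ?linearD ?linearZ /= ?(pureDl, pureDr, pureZl, pureZr).
Qed.

Lemma tensor_map_pure m n : tensor_map (pure m n) = pure (f m) (g n).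
Proof. exact: tensor_lift_pure tensor_map_bilinear _ _. Qed.

Fact tensor_map_linear : linear tensor_map.
Proof. exact: tensor_lift_linear tensor_map_bilinear. Qed.

HB.instance Definition _ :=
  GRing.isLinear.Build R _ _ *:%R tensor_map tensor_map_linear.

End TensorMap.

Section Restriction.
Variables (R S : comPzRingType) (phi : {rmorphism R -> S}) (N : lmodType S).

Definition restrict of {rmorphism R -> S} : Type := N.
Local Notation rN := (restrict phi).
HB.instance Definition _ := GRing.Zmodule.on rN.

Definition restrict_scale (r : R) (x : rN) : rN := phi r *: (x : N).

Fact restrict_scaleA a b x :
  restrict_scale a (restrict_scale b x) = restrict_scale (a * b) x.
Proof. by rewrite /restrict_scale scalerA rmorphM. Qed.
Fact restrict_scale1 : left_id 1 restrict_scale.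
Proof. by move=> x; rewrite /restrict_scale rmorph1 scale1r. Qed.
Fact restrict_scaleDr : right_distributive restrict_scale +%R.
Proof. by move=> a x y; apply: scalerDr. Qed.
Fact restrict_scaleDl x : {morph restrict_scale^~ x : a b / a + b}.
Proof. by move=> a b; rewrite /restrict_scale rmorphD; apply: scalerDl. Qed.

HB.instance Definition _ := GRing.Zmodule_isLmodule.Build R rN
  restrict_scaleA restrict_scale1 restrict_scaleDr restrict_scaleDl.

End Restriction.

Section BaseChange.
Variables (R S : comPzRingType) (phi : {rmorphism R -> S}).

(* S viewed as an R-module. *)
Local Notation SR := (restrict S^o phi).

Definition smul (s : S) (t : SR) : SR := (s : S) * (t : S).
Fact smul_linear s : linear (smul s).
Proof.
move=> r x y; rewrite /smul /GRing.scale /= /restrict_scale /GRing.scale /=.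
by rewrite mulrDr mulrCA.
Qed.
HB.instance Definition _ (s : S) :=
  GRing.isLinear.Build R SR SR *:%R (smul s) (smul_linear s).

(* S (x)_R M, with S acting on the left factor. *)
Definition base_change (M : lmodType R) : Type := tensor SR M.

Section Module.
Variable M : lmodType R.
HB.instance Definition _ := GRing.Zmodule.on (base_change M).

Definition base_change_scale (s : S) (x : base_change M) : base_change M :=
  tensor_map (smul s) (idfun : {linear M -> M}) x.

Fact base_change_scaleA a b x :
  base_change_scale a (base_change_scale b x) = base_change_scale (a * b) x.
Proof.
apply: (tensor_ext
  (f := tensor_map (smul a) idfun \o tensor_map (smul b) idfun)) => t m /=.
by rewrite !tensor_map_pure; congr pure; apply: mulrA.
Qed.

Fact base_change_scale1 : left_id 1 base_change_scale.
Proof.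
apply: (tensor_ext (f := tensor_map (smul 1) idfun) (g := idfun)) => t m.
by apply: (etrans (tensor_map_pure _ _ _ _)); congr pure; apply: mul1r.
Qed.

Fact base_change_scaleDr : right_distributive base_change_scale +%R.
Proof. by move=> a x y; apply: linearD. Qed.

Fact base_change_scaleDl x : {morph base_change_scale^~ x : a b / a + b}.
Proof.
move=> a b; apply: (tensor_ext (f := tensor_map (smul (a + b)) idfun)
  (g := tensor_map (smul a) idfun \+ tensor_map (smul b) idfun)) => t m /=.
by rewrite !tensor_map_pure -pureDl; congr pure; apply: mulrDl.
Qed.

HB.instance Definition _ := GRing.Zmodule_isLmodule.Build S (base_change M)
  base_change_scaleA base_change_scale1 base_change_scaleDr base_change_scaleDl.

End Module.

Definition base_change_map (M N : lmodType R) (f : {linear M -> N}) :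
    base_change M -> base_change N :=
  tensor_map (idfun : {linear SR -> SR}) f.

Fact base_change_map_linear (M N : lmodType R) (f : {linear M -> N}) :
  linear (base_change_map f).
Proof.
move=> s x y; rewrite [LHS](linearD (tensor_map idfun f)); congr (_ + _).
apply: (tensor_ext (f := tensor_map idfun f \o tensor_map (smul s) idfun)
  (g := tensor_map (smul s) idfun \o tensor_map idfun f)) => t m /=.
by rewrite !tensor_map_pure.
Qed.
HB.instance Definition _ (M N : lmodType R) (f : {linear M -> N}) :=
  GRing.isLinear.Build S _ _ *:%R
  (@base_change_map M N f) (@base_change_map_linear M N f).

Definition base_change_chain (X : chain R) : chain S :=
  @Chain S (fun n => base_change (X n))
    (fun n => base_change_map (chain_diff X n)).

End BaseChange.

Arguments base_change_map {R S} phi {M N} f.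

Definition flat (R : comPzRingType) (F : lmodType R) : Prop :=
  forall (A B D : lmodType R) (f : {linear A -> B}) (g : {linear B -> D}),
    exact_at f g ->
    exact_at (tensor_map (idfun : {linear F -> F}) f)
             (tensor_map (idfun : {linear F -> F}) g).

Definition flat_morphism (R S : comPzRingType) (phi : {rmorphism R -> S}) :
    Prop :=
  flat (restrict S^o phi).

Section ProperResolution.
Variable R : comPzRingType.

Definition isomorphic (M N : lmodType R) : Prop :=
  exists f : {linear M -> N}, bijective f.

(* X belongs to the class P_C(R). *)
Definition in_PC (C X : lmodType R) : Prop :=
  exists P : lmodType R, projective P /\ isomorphic X (tensor P C).

Definition proper_PC_resolution (C M : lmodType R) (X : chain R)
    (eps : {linear X 0 -> M}) : Prop :=
  [/\ forall n, in_PC C (X n),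
      is_complex (augment eps)
    & forall Y : lmodType R, in_PC C Y ->
        exact_chain (hom_chain Y (augment eps))].

End ProperResolution.

Arguments proper_PC_resolution {R} C {M} X eps.

(* Main.v *)
From HB Require Import structures.
From mathcomp Require Import all_boot all_algebra boolp.
Require Import Defs.

Set Implicit Arguments.
Unset Strict Implicit.
Unset Printing Implicit Defensive.

Import GRing.Theory.
Local Open Scope ring_scope.

(** The class [P_C(S)] is stable under base change because [S (x) P] is
    projective over [S] when [P] is projective over [R], and
    [S (x)_R (P (x)_R C)] is [(S (x)_R P) (x)_S (S (x)_R C)].  This settles the
    terms of the base-changed resolution, and it is a complex by functoriality.

    For the exactness of [Hom_S(Y, -)] on the base change of [L^+], with
    [Y = Q (x)_S (S (x)_R C)] and [Q] projective over [S], adjunction gives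
      [Hom_S(Y, -) = Hom_S(Q, Hom_S(S (x)_R C, -))],
    and [Hom_S(Q, -)] is exact, so only the test object [S (x)_R C] matters
    ([hom_tensor_exact]).  As [R] is noetherian, [C] is finitely presented
    ([finite_presentation]), and as [S] is flat, the natural map
      [S (x)_R Hom_R(C, N) -> Hom_S(S (x)_R C, S (x)_R N)]
    is bijective ([base_change_hom_bij]): both sides are the kernel of the map
    from [(S (x) N)^n] to [(S (x) N)^m] given by a presentation of [C].  Hence
    [Hom_S(S (x)_R C, S (x)_R L^+)] is [S (x)_R Hom_R(C, L^+)]
    ([base_change_hom_exact]).  Now [C] itself is in [P_C(R)], being
    [R (x) C], so [Hom_R(C, L^+)] is exact by properness of [L], and flatness
    concludes.

    All the exactness statements are about one pair of composable maps at a
    time.  Surjectivity at the right end is exactness at a map to zero, for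
    which the zero endomorphism serves as the second map of the pair. *)

(** * Linear maps *)

Section LinearMaps.
Variable R : comPzRingType.

Definition linear_of (M N : lmodType R) (f : M -> N) (lf : linear f) :
    {linear M -> N} :=
  HB.pack f (GRing.isLinear.Build R M N *:%R f lf).

Definition zero_map (M N : lmodType R) : {linear M -> N} := \0.

Fact eval_linear (M N : lmodType R) (x : M) :
  linear ((fun f : hom M N => f x) : hom M N -> N).
Proof. by []. Qed.
Definition eval_map (M N : lmodType R) (x : M) : {linear hom M N -> N} :=
  linear_of (@eval_linear M N x).

Fact hom_scaleE (M N : lmodType R) (r : R) (f : hom M N) (x : M) :
  (r *: f) x = r *: f x.
Proof. by []. Qed.

Fact coord_linear (N : lmodType R) n (i : 'I_n) :
  linear ((fun x : {ffun 'I_n -> N} => x i) : {ffun 'I_n -> N} -> N).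
Proof. by move=> r x y /=; rewrite !ffunE. Qed.
Definition coord_map (N : lmodType R) n (i : 'I_n) :
    {linear {ffun 'I_n -> N} -> N} := linear_of (@coord_linear N n i).

Fact inj_linear (N : lmodType R) n (i : 'I_n) :
  linear ((fun y : N => [ffun j => if j == i then y else 0])
    : N -> {ffun 'I_n -> N}).
Proof.
by move=> r x y /=; apply/ffunP => j; rewrite !ffunE; case: ifP => _ //;
  rewrite scaler0 addr0.
Qed.
Definition inj_map (N : lmodType R) n (i : 'I_n) :
    {linear N -> {ffun 'I_n -> N}} := linear_of (@inj_linear N n i).

Fact comb_linear (N : lmodType R) n (a : 'I_n -> R) :
  linear ((fun x : {ffun 'I_n -> N} => \sum_i a i *: x i)
    : {ffun 'I_n -> N} -> N).
Proof.
move=> r x y /=; rewrite scaler_sumr -big_split; apply: eq_bigr => i _ /=.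
by rewrite !ffunE scalerDr !scalerA mulrC.
Qed.
Definition comb_map (N : lmodType R) n (a : 'I_n -> R) :
    {linear {ffun 'I_n -> N} -> N} := linear_of (@comb_linear N n a).

Fact lin_comb_linear (N : lmodType R) n (g : 'I_n -> N) :
  linear ((fun a : {ffun 'I_n -> R^o} => \sum_i a i *: g i)
    : {ffun 'I_n -> R^o} -> N).
Proof.
move=> r x y /=; rewrite scaler_sumr -big_split; apply: eq_bigr => i _ /=.
by rewrite !ffunE scalerA -scalerDl.
Qed.
Definition lin_comb_map (N : lmodType R) n (g : 'I_n -> N) :
    {linear {ffun 'I_n -> R^o} -> N} := linear_of (@lin_comb_linear N n g).

Fact family_linear (M N : lmodType R) n (f : 'I_n -> {linear M -> N}) :
  linear ((fun x : M => [ffun i => f i x]) : M -> {ffun 'I_n -> N}).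
Proof. by move=> r x y /=; apply/ffunP => i; rewrite !ffunE linearP. Qed.
Definition family_map (M N : lmodType R) n (f : 'I_n -> {linear M -> N}) :
    {linear M -> {ffun 'I_n -> N}} := linear_of (family_linear f).

End LinearMaps.

(** * Finite presentation over a noetherian ring *)

Section Noetherian.
Variable R : comPzRingType.

Definition noetherian_module (M : lmodType R) : Prop :=
  forall I : M -> Prop, is_submodule I -> submodule_fg I.

Lemma submodule_sum (M : lmodType R) (I : M -> Prop) n (a : 'I_n -> R)
    (g : 'I_n -> M) :
  is_submodule I -> (forall i, I (g i)) -> I (\sum_i a i *: g i).
Proof.
move=> [I0 ID IZ] Ig; apply: big_ind => // i _.
exact: IZ.
Qed.

(** Generators of a submodule [I] of the middle term are found on both sides:
    lifts to [I] of generators of its image, together with images of generators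
    of its preimage. *)
Lemma noetherian_ext (M1 M2 M3 : lmodType R) (g : {linear M1 -> M2})
    (h : {linear M2 -> M3}) :
  exact_at g h -> noetherian_module M1 -> noetherian_module M3 ->
  noetherian_module M2.
Proof.
move=> gh noeth1 noeth3 I subI; have [I0 ID IZ] := subI.
have [p [b bP]] : submodule_fg (fun y => exists2 x, I x & h x = y).
  apply: noeth3; split.
  - by exists 0; rewrite ?linear0.
  - move=> _ _ [x Ix <-] [y Iy <-].
    by exists (x + y); rewrite ?linearD //; auto.
  - by move=> r _ [x Ix <-]; exists (r *: x); rewrite ?linearZ //; auto.
have [q [c cP]] : submodule_fg (fun x => I (g x)).
  apply: noeth1; split.
  - by rewrite linear0.
  - by move=> x y Ix Iy; rewrite linearD; auto.
  - by move=> r x Ix; rewrite linearZ; apply: IZ.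
have Ic k : I (g (c k)).
  apply/cP; exists (fun j => (j == k)%:R); rewrite (bigD1 k) //= eqxx scale1r.
  by rewrite big1 ?addr0 // => j /negPf ->; rewrite scale0r.
have lift_b k : exists x, I x /\ h x = b k.
  have [|x Ix xE] := (bP (b k)).2; last by exists x.
  exists (fun j => (j == k)%:R); rewrite (bigD1 k) //= eqxx scale1r.
  by rewrite big1 ?addr0 // => j /negPf ->; rewrite scale0r.
have [B BP] := choice lift_b.
pose G (i : 'I_(p + q)) : M2 :=
  match split i with inl k => B k | inr k => g (c k) end.
have GE (a : 'I_(p + q) -> R) : \sum_i a i *: G i =
    \sum_k a (lshift q k) *: B k + g (\sum_k a (rshift p k) *: c k).
  rewrite big_split_ord linear_sum; congr (_ + _); apply: eq_bigr => k _.
    by rewrite /G (unsplitK (inl k)).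
  by rewrite linearZ /G (unsplitK (inr k)).
exists (p + q)%N, G => x; split=> [Ix|[a ->]]; last first.
  rewrite GE; apply: ID; first by apply: submodule_sum => // k; case: (BP k).
  by rewrite linear_sum; under eq_bigr do rewrite linearZ /=;
    apply: submodule_sum.
have [a aE] := (bP (h x)).1 (ex_intro2 _ _ x Ix erefl).
have IB : I (x - \sum_k a k *: B k).
  apply: ID => //; rewrite -scaleN1r; apply: IZ; apply: submodule_sum => // k.
  by case: (BP k).
have [|z zE] := (gh (x - \sum_k a k *: B k)).1.
  rewrite linearB aE linear_sum; apply/eqP; rewrite subr_eq0; apply/eqP.
  by apply: eq_bigr => k _; rewrite linearZ /= (BP k).2.
have [|a' a'E] := (cP z).1; first by rewrite zE.
(* [a] expresses [h x] in terms of the [b k]; what is left of [x] after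
   subtracting the corresponding combination of the lifts comes from [M1]. *)
exists (fun i => match split i with inl k => a k | inr k => a' k end).
rewrite GE; under eq_bigr do rewrite (unsplitK (inl _)).
under [X in g X]eq_bigr do rewrite (unsplitK (inr _)).
by rewrite -a'E zE addrC subrK.
Qed.

Fact cons0_linear n : linear ((fun a : {ffun 'I_n -> R^o} =>
    [ffun i : 'I_n.+1 => oapp a (0 : R^o) (unlift ord0 i)])
  : {ffun 'I_n -> R^o} -> {ffun 'I_n.+1 -> R^o}).
Proof.
move=> r x y; apply/ffunP => i; rewrite !ffunE.
by case: unliftP => [j|] _ /=; rewrite ?ffunE // scaler0 addr0.
Qed.

(** Induction on the rank, along [0 -> R^n -> R^(n+1) -> R -> 0], where the
    projection is the coordinate of index 0. *)
Lemma noetherian_free n :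
  noetherian R -> noetherian_module {ffun 'I_n -> R^o}.
Proof.
move=> noethR; elim: n => [|n IHn].
  move=> I [I0 _ _]; exists 0%N, (fun=> 0) => x; split=> [_|[a ->]].
    by exists (fun=> 0); apply/ffunP => -[].
  by rewrite big_ord0.
apply: (@noetherian_ext _ _ R^o (linear_of (@cons0_linear n))
  (coord_map _ ord0)) => // x; split=> /= [x0|[y <-]]; last first.
  by rewrite ffunE unlift_none.
exists [ffun j => x (lift ord0 j)]; apply/ffunP => i; rewrite ffunE.
by case: unliftP => [j ->|->] /=; rewrite ?ffunE ?x0.
Qed.

(** Over a noetherian ring a finite generating family has finitely many
    relations [rel j] that imply all the others, so that they are the only
    conditions on the images of the generators under a linear map. *)
Lemma finite_presentation (C : lmodType R) :
  noetherian R -> finitely_generated C ->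
  exists n (g : 'I_n -> C) m (rel : 'I_m -> {ffun 'I_n -> R^o}),
  [/\ forall c, exists a : {ffun 'I_n -> R^o}, c = \sum_i a i *: g i,
      forall j, \sum_i rel j i *: g i = 0
    & forall (N : lmodType R) (x : 'I_n -> N),
        (forall j, \sum_i rel j i *: x i = 0) ->
        exists f : {linear C -> N}, forall i, f (g i) = x i].
Proof.
move=> noethR [n [g gP]].
have [m [rel relP]] : submodule_fg
    (fun a : {ffun 'I_n -> R^o} => lin_comb_map g a = 0).
  apply: noetherian_free => //; split=> [|x y x0 y0|r x x0].
  - exact: linear0.
  - by rewrite linearD x0 y0 addr0.
  - by rewrite linearZ x0 /= scaler0.
have gen c : exists a : {ffun 'I_n -> R^o}, c = \sum_i a i *: g i.
  have [a ->] := (gP c).1 I; exists [ffun i => a i].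
  by apply: eq_bigr => i _; rewrite ffunE.
exists n, g, m, rel; split=> // [j|N x x0].
  apply/(relP (rel j)); exists (fun k => (k == j)%:R).
  rewrite (bigD1 j) //= eqxx scale1r.
  by rewrite big1 ?addr0 // => k /negPf ->; rewrite scale0r.
(* The value at [c] is read off any expression of [c] in the generators; two
   expressions differ by a relation, on which [x] gives zero. *)
have wd a : lin_comb_map g a = 0 -> lin_comb_map x a = 0.
  move=> /relP[b ->]; rewrite linear_sum big1 // => j _.
  by rewrite linearZ /= x0 scaler0.
have wd2 a b : lin_comb_map g a = lin_comb_map g b ->
    lin_comb_map x a = lin_comb_map x b.
  move=> ab; apply/eqP; rewrite -subr_eq0 -linearB; apply/eqP/wd.
  by rewrite linearB ab subrr.
have [s sP] := choice gen.
have lf : linear ((fun c => lin_comb_map x (s c)) : C -> N).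
  move=> r c d; rewrite -linearP; apply: wd2.
  by rewrite linearP /= -!sP.
exists (linear_of lf) => i /=.
pose e : {ffun 'I_n -> R^o} := [ffun j => (j == i)%:R].
have eP (M : lmodType R) (y : 'I_n -> M) : lin_comb_map y e = y i.
  rewrite /= (bigD1 i) //= ffunE eqxx scale1r.
  by rewrite big1 ?addr0 // => k /negPf ki; rewrite ffunE ki scale0r.
by rewrite -(eP N x); apply: wd2; rewrite eP /= -sP.
Qed.

End Noetherian.

(** * Extension of scalars *)

Section ExtensionOfScalars.
Variables (R S : comPzRingType) (phi : {rmorphism R -> S}).

Fact restrict_map_linear (A B : lmodType S) (f : {linear A -> B}) :
  linear (f : restrict A phi -> restrict B phi).
Proof. by move=> r x y; apply: (linearP f). Qed.
Definition restrict_map (A B : lmodType S) (f : {linear A -> B}) :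
    {linear restrict A phi -> restrict B phi} :=
  linear_of (restrict_map_linear f).

(** The pure tensor, with its left factor in the ring [S] itself so that it can
    be multiplied and acted on in [S]. *)
Definition bpure (M : lmodType R) (s : S) (m : M) : base_change phi M :=
  pure (s : restrict S^o phi) m.

Lemma bpureZ (M : lmodType R) (s t : S) (m : M) :
  s *: bpure t m = bpure (s * t) m.
Proof. exact: (tensor_map_pure (smul s) (idfun : {linear M -> M})). Qed.

Lemma bpureE (M : lmodType R) (s : S) (m : M) : bpure s m = s *: bpure 1 m.
Proof. by rewrite bpureZ mulr1. Qed.

Lemma base_change_map_bpure (M N : lmodType R) (f : {linear M -> N}) s m :
  base_change_map phi f (bpure s m) = bpure s (f m).
Proof. exact: tensor_map_pure. Qed.

Lemma bpureDr (M : lmodType R) (s : S) (m n : M) :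
  bpure s (m + n) = bpure s m + bpure s n.
Proof. exact: pureDr. Qed.

Lemma bpureZr (M : lmodType R) (s : S) (r : R) (m : M) :
  bpure s (r *: m) = phi r *: bpure s m.
Proof. by rewrite /bpure pureZr -pureZl; apply: esym; apply: bpureZ. Qed.

Fact bpure_linear (M : lmodType R) (s : S) :
  linear (bpure s : M -> restrict (base_change phi M) phi).
Proof. by move=> r x y; rewrite bpureDr bpureZr. Qed.
Definition bpure_map (M : lmodType R) (s : S) :
    {linear M -> restrict (base_change phi M) phi} :=
  linear_of (@bpure_linear M s).

Lemma bpure0 (M : lmodType R) (s : S) : bpure s (0 : M) = 0.
Proof. exact: (linear0 (bpure_map M s)). Qed.

Lemma base_change_ind (M : lmodType R) (K : base_change phi M -> Prop) :
  K 0 -> (forall s m, K (bpure s m)) -> (forall x y, K x -> K y -> K (x + y)) ->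
  forall x, K x.
Proof.
by move=> K0 Kp KD; apply: tensor_ind => // s m x Kx; apply: KD.
Qed.

Lemma base_change_ext (M : lmodType R) (K : lmodType S)
    (f g : {linear base_change phi M -> K}) :
  (forall m, f (bpure 1 m) = g (bpure 1 m)) -> f =1 g.
Proof.
move=> fg; elim/base_change_ind => [|s m|x y fx fy]; first by rewrite !linear0.
  by rewrite bpureE !linearZ fg.
by rewrite !linearD fx fy.
Qed.

Section Lift.
Variables (M : lmodType R) (K : lmodType S).
Variable f : {linear M -> restrict K phi}.

(** Source and target are typed as [R]-modules, as [tensor_lift] requires, while
    the scalar action in the body has to be that of [S]. *)
Definition base_change_lift_pair (s : restrict S^o phi) (m : M) :
    restrict K phi :=
  let y : K := f m in @GRing.scale S K s y.

Fact base_change_lift_bilinear : bilinear_map base_change_lift_pair.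
Proof.
rewrite /base_change_lift_pair.
split=> [s t m|s m n|r s m|r s m].
- exact: (@scalerDl S K (f m) s t).
- by rewrite linearD; apply: (@scalerDr S K).
- by apply: esym; apply: (@scalerA S K (phi r) s (f m)).
- rewrite linearZ; have := @scalerA S K (phi r) s (f m).
  by rewrite mulrC -(@scalerA S K); apply: esym.
Qed.

(** Extension of scalars is left adjoint to restriction: this is the [S]-linear
    map corresponding to [f]. *)
Definition base_change_lift (x : base_change phi M) : K :=
  tensor_lift base_change_lift_pair x.

Lemma base_change_lift_bpure s m :
  base_change_lift (bpure s m) = s *: (f m : K).
Proof. exact: (tensor_lift_pure base_change_lift_bilinear). Qed.

Lemma base_change_lift0 : base_change_lift 0 = 0.
Proof.
by rewrite -[RHS](scale0r (f 0 : K)) -base_change_lift_bpure;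
  congr base_change_lift; rewrite bpureE scale0r.
Qed.

Lemma base_change_liftD x y :
  base_change_lift (x + y) = base_change_lift x + base_change_lift y.
Proof.
have := tensor_lift_linear base_change_lift_bilinear 1 x y.
by rewrite !scale1r.
Qed.

Fact base_change_lift_linear : linear base_change_lift.
Proof.
move=> s x y; rewrite base_change_liftD; congr (_ + _).
elim/base_change_ind: x => [|t m|u v IHu IHv].
- by rewrite scaler0 base_change_lift0 scaler0.
- by rewrite bpureZ !base_change_lift_bpure scalerA.
- by rewrite scalerDr !base_change_liftD IHu IHv scalerDr.
Qed.

HB.instance Definition _ :=
  GRing.isLinear.Build S (base_change phi M) K *:%R
    base_change_lift base_change_lift_linear.

End Lift.

(** Lifting problems for [S (x) P] over [S] are, by adjunction, lifting problems
    for [P] over [R], and restriction of scalars preserves surjections. *)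
Lemma projective_base_change (P : lmodType R) :
  projective P -> projective (base_change phi P).
Proof.
move=> projP A B g h surj_g.
have [k kE] := projP _ _ (restrict_map g)
  (restrict_map h \o bpure_map P 1 : {linear P -> restrict B phi}) surj_g.
exists (base_change_lift k).
apply: (base_change_ext (f := g \o base_change_lift k)) => m /=.
by rewrite base_change_lift_bpure scale1r; apply: kE.
Qed.

End ExtensionOfScalars.
Arguments bpure_map {R S} phi M s.

Section BaseChangeMaps.
Variables (R S : comPzRingType) (phi : {rmorphism R -> S}).

(** The composite is given up to pointwise equality, so that [h] can be a known
    map (an identity, zero, a scaling) to which the composite simplifies. *)
Lemma base_change_map_comp (M N K : lmodType R) (f : {linear M -> N})
    (g : {linear N -> K}) (h : {linear M -> K}) x :
  (forall y, g (f y) = h y) ->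
  base_change_map phi g (base_change_map phi f x) = base_change_map phi h x.
Proof.
move=> gf; elim/base_change_ind: x => [|s m|x y IHx IHy].
- by rewrite !linear0.
- by rewrite !base_change_map_bpure gf.
- by rewrite !linearD /= IHx IHy.
Qed.

Fact base_change_map_zero (M N : lmodType R) x :
  base_change_map phi (zero_map M N) x = 0.
Proof.
elim/base_change_ind: x => [|s m|x y IHx IHy]; first by rewrite linear0.
  by rewrite base_change_map_bpure; apply: (linear0 (bpure_map phi N s)).
by rewrite linearD /= IHx IHy addr0.
Qed.

(** Base change commutes with finite powers: this lemma and [coord_sum_inj] say
    that base-changing the coordinates and the injections gives mutually
    inverse maps between [S (x) N^n] and [(S (x) N)^n]. *)
Lemma base_change_ffunK (N : lmodType R) n
    (z : base_change phi {ffun 'I_n -> N}) :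
  z = \sum_i base_change_map phi (inj_map N i)
        (base_change_map phi (coord_map N i) z).
Proof.
elim/base_change_ind: z => [|s x|x y IHx IHy].
- by rewrite big1 // => i _; rewrite !linear0.
- under eq_bigr do rewrite !base_change_map_bpure.
  have xE : x = \sum_i inj_map N i (x i).
    apply/ffunP => j; rewrite sum_ffunE (bigD1 j) //= big1 => [|i /negPf ij].
      by rewrite ffunE eqxx addr0.
    by rewrite ffunE eq_sym ij.
  rewrite [in LHS]xE [LHS](linear_sum (bpure_map phi _ s)).
  exact: eq_bigr.
- rewrite {1}IHx {1}IHy -big_split; apply: eq_bigr => i _.
  by rewrite !linearD.
Qed.

Lemma base_change_map_id (N : lmodType R) x :
  base_change_map phi (idfun : {linear N -> N}) x = x.
Proof.
elim/base_change_ind: x => [|s m|u v IHu IHv].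
- by rewrite linear0.
- by rewrite base_change_map_bpure.
- by rewrite linearD /= IHu IHv.
Qed.

Lemma coord_sum_inj (N : lmodType R) n (y : 'I_n -> base_change phi N) i :
  base_change_map phi (coord_map N i)
    (\sum_j base_change_map phi (inj_map N j) (y j)) = y i.
Proof.
rewrite linear_sum (bigD1 i) //= big1 => [|j /negPf ji].
  rewrite (base_change_map_comp (h := idfun)) => [|x].
    by rewrite base_change_map_id addr0.
  by rewrite /= ffunE eqxx.
rewrite (base_change_map_comp (h := zero_map N N)) ?base_change_map_zero //.
by move=> x; rewrite /= ffunE eq_sym ji.
Qed.
End BaseChangeMaps.

(** * Base change of Hom modules *)

Section BaseChangeHom.
Variables (R S : comPzRingType) (phi : {rmorphism R -> S}).

Fact hom_to_base_change_linear (C N : lmodType R) :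
  linear ((fun f => base_change_map phi f) :
    hom C N -> restrict (hom (base_change phi C) (base_change phi N)) phi).
Proof.
move=> r f g; apply: homP; apply: base_change_ext => c.
rewrite /= base_change_map_bpure.
rewrite [LHS](linearP (bpure_map phi N 1)) /=.
by rewrite -!base_change_map_bpure.
Qed.

Definition hom_to_base_change (C N : lmodType R) :
    {linear hom C N ->
      restrict (hom (base_change phi C) (base_change phi N)) phi} :=
  linear_of (@hom_to_base_change_linear C N).

(** The natural map, which sends [s (x) f] to [s] times the base change of
    [f]. *)
Definition base_change_hom (C N : lmodType R) :
    base_change phi (hom C N) -> hom (base_change phi C) (base_change phi N) :=
  base_change_lift (hom_to_base_change C N).
HB.instance Definition _ (C N : lmodType R) :=
  GRing.isLinear.Build S (base_change phi (hom C N))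
    (hom (base_change phi C) (base_change phi N)) *:%R (@base_change_hom C N)
    (base_change_lift_linear (hom_to_base_change C N)).

(** An [S]-linear map out of [S (x) C] is determined on the elements [1 (x) c],
    and there the natural map is the base change of an evaluation, hence an
    operation on which flatness can act. *)
Lemma base_change_homE (C N : lmodType R)
    (w : base_change phi (hom C N)) c :
  base_change_hom w (bpure phi 1 c) = base_change_map phi (eval_map N c) w.
Proof.
elim/base_change_ind: w => [|s f|x y IHx IHy].
- by rewrite !linear0.
- rewrite /base_change_hom base_change_lift_bpure hom_scaleE /=.
  by rewrite !base_change_map_bpure bpureZ mulr1.
- by rewrite !linearD /= -IHx -IHy.
Qed.

(** Naturality in the second argument, which lets [base_change_hom] transport
    the exactness of complexes. *)
Lemma base_change_hom_post (C M N : lmodType R) (f : {linear M -> N})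
    (w : base_change phi (hom C M)) :
  base_change_hom
    (base_change_map phi (hom_post f : {linear hom C M -> hom C N}) w) =
  hom_post (base_change_map phi f) (base_change_hom w).
Proof.
apply: homP; apply: base_change_ext => c /=.
rewrite !base_change_homE (base_change_map_comp (h := f \o eval_map M c)) //.
by apply: esym; apply: base_change_map_comp.
Qed.

Lemma bpure_sum (C : lmodType R) (K : lmodType S)
    (h : {linear base_change phi C -> K}) n (a : 'I_n -> R) (g : 'I_n -> C) :
  h (bpure phi 1 (\sum_i a i *: g i)) =
  \sum_i phi (a i) *: h (bpure phi 1 (g i)).
Proof.
rewrite [X in h X](linear_sum (bpure_map phi C 1)) linear_sum.
by apply: eq_bigr => i _; rewrite /= bpureZr linearZ.
Qed.

Lemma base_change_map_scale (N : lmodType R) (r : R) x :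
  base_change_map phi (r \*: (idfun : {linear N -> N})) x = phi r *: x.
Proof.
elim/base_change_ind: x => [|s m|x y IHx IHy].
- by rewrite linear0 scaler0.
- by rewrite base_change_map_bpure /= bpureZr.
- by rewrite linearD /= IHx IHy scalerDr.
Qed.

(** With [S] flat, the evaluations at the generators [g] embed [S (x) Hom(C, N)]
    in [S (x) N^n], with image the kernel of the map to [S (x) N^m] given by the
    relations.  The linear maps from [C] to [S (x) N] are the families in
    [(S (x) N)^n] that satisfy the same relations. *)
Lemma base_change_hom_bij (C N : lmodType R) :
  noetherian R -> finitely_generated C -> flat_morphism phi ->
  injective (@base_change_hom C N) /\
  (forall h, exists w, @base_change_hom C N w = h).
Proof.
move=> noethR fgC flat_phi.
have [n [g [m [rel [gen rel0 ext]]]]] := finite_presentation noethR fgC.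
pose E : {linear hom C N -> {ffun 'I_n -> N}} :=
  family_map (fun i => eval_map N (g i)).
pose A : {linear {ffun 'I_n -> N} -> {ffun 'I_m -> N}} :=
  family_map (fun j => comb_map N (rel j)).
(* Injectivity of [E] is phrased as exactness at a zero map so that flatness
   applies to it. *)
have E_inj f : E f = 0 <-> exists x, zero_map (hom C N) (hom C N) x = f.
  split=> [f0|[x <-]]; last exact: linear0.
  exists 0; apply: homP => c; have [a ->] := gen c.
  rewrite [RHS]linear_sum [RHS]big1 // => i _; rewrite linearZ /=.
  have : E f i = 0 by rewrite f0 ffunE.
  by rewrite ffunE /= => ->; rewrite scaler0.
have EA : exact_at E A.
  move=> x; split=> [Ax|[f <-]].
    have [j|f fE] := ext N x.
      by have : A x j = 0 by [rewrite Ax ffunE]; rewrite ffunE.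
    by exists (f : hom C N); apply/ffunP => i; rewrite ffunE; apply: fE.
  apply/ffunP => j; rewrite !ffunE /=.
  rewrite -[RHS](linear0 (f : {linear C -> N})) -[in RHS](rel0 j) linear_sum.
  by apply: eq_bigr => i _; rewrite ffunE linearZ.
have sE w i : base_change_map phi (coord_map N i) (base_change_map phi E w) =
    base_change_map phi (eval_map N (g i)) w.
  by apply: base_change_map_comp => f; rewrite /= ffunE.
have sE_inj w : base_change_map phi E w = 0 -> w = 0.
  move=> /(flat_phi _ _ _ _ _ E_inj)[x <-].
  exact: base_change_map_zero.
split=> [v w vw|h].
  apply/eqP; rewrite -subr_eq0; apply/eqP; apply: sE_inj.
  rewrite [LHS]base_change_ffunK big1 // => i _.
  by rewrite sE -base_change_homE linearB /= vw subrr linear0.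
(* [z] is the element of [S (x) N^n] that corresponds to the family of the
   values of [h] at the generators; these satisfy the relations of [C]. *)
pose z := \sum_i base_change_map phi (inj_map N i) (h (bpure phi 1 (g i))).
have /(flat_phi _ _ _ _ _ EA)[w wE] : base_change_map phi A z = 0.
  rewrite [LHS]base_change_ffunK big1 // => j _.
  rewrite (base_change_map_comp (h := comb_map N (rel j))) => [|x]; last first.
    by rewrite /= ffunE.
  rewrite [X in base_change_map _ _ X](_ : _ = 0) ?linear0 //.
  rewrite linear_sum /=; under eq_bigr => i _.
    rewrite (base_change_map_comp
      (h := (rel j i : R) \*: (idfun : {linear N -> N}))) => [|x]; last first.
      rewrite /= (bigD1 i) //= big1 => [|k /negPf ki]; rewrite ffunE.
        by rewrite eqxx addr0.
      by rewrite ki scaler0.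
    rewrite base_change_map_scale; over.
  by rewrite -bpure_sum rel0 bpure0 linear0.
rewrite -/(base_change_map phi E w) in wE.
exists w; apply: homP; apply: base_change_ext => c.
have [a ->] := gen c.
rewrite !bpure_sum; apply: eq_bigr => i _; congr (_ *: _).
by rewrite base_change_homE -sE wE coord_sum_inj.
Qed.
End BaseChangeHom.

(** * Exactness of Hom *)

(** Only elements are chased, so the vertical maps need not be linear.  Over the
    first two terms elements are pulled back; the last map carries the vanishing
    of [g y] to and from that of [g' (b y)]. *)
Lemma exact_at_transport (T U V T' U' V' : nmodType)
    (f : T -> U) (g : U -> V) (f' : T' -> U') (g' : U' -> V')
    (a : T -> T') (b : U -> U') (c : V -> V') :
  (forall y, exists x, a x = y) -> (forall y, exists x, b x = y) ->
  injective c -> c 0 = 0 ->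
  (forall x, f' (a x) = b (f x)) -> (forall x, g' (b x) = c (g x)) ->
  exact_at f g -> exact_at f' g'.
Proof.
move=> surj_a surj_b inj_c c0 fab gbc fg y'; split=> [|[x' <-]].
  have [y <-] := surj_b y'; rewrite gbc -c0 => /inj_c /fg[x <-].
  by exists (a x).
have [x <-] := surj_a x'; rewrite fab gbc -c0; congr c.
by apply/fg; exists x.
Qed.

(** The kernel is made into a module in its own right, because projectivity is
    stated for surjections onto modules and is applied here to a corestricted
    map. *)
Section Kernel.
Variables (R : comPzRingType) (B D : lmodType R) (g : {linear B -> D}).

Definition in_kernel : pred B := fun x => g x == 0.

Fact in_kernel_closed : GRing.subsemimod_closed in_kernel.
Proof.
split; first split.
- by rewrite unfold_in /in_kernel linear0.
- move=> x y; rewrite !unfold_in /in_kernel linearD => /eqP-> /eqP->.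
  by rewrite addr0.
- move=> r x; rewrite !unfold_in /in_kernel linearZ => /eqP-> /=.
  by rewrite scaler0.
Qed.
HB.instance Definition _ :=
  GRing.isSubmodClosed.Build R B in_kernel in_kernel_closed.

Record kernel : Type := Kernel { kernel_val :> B; _ : in_kernel kernel_val }.
HB.instance Definition _ := [isSub for kernel_val].
HB.instance Definition _ := [Choice of kernel by <:].
HB.instance Definition _ := [SubChoice_isSubLmodule of kernel by <:].
End Kernel.

Section HomExactness.
Variable R : comPzRingType.

(** A map into the kernel of [g] is lifted through the corestriction of [f] to
    that kernel, which is surjective by exactness. *)
Lemma projective_hom_exact (Q A B D : lmodType R)
    (f : {linear A -> B}) (g : {linear B -> D}) :
  projective Q -> exact_at f g ->
  exact_at (@hom_post R Q _ _ f) (@hom_post R Q _ _ g).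
Proof.
move=> projQ fg h; split=> [gh|[k <-]]; last first.
  by apply: homP => x /=; apply/fg; exists (k x).
have kerf x : in_kernel g (f x) by apply/eqP/fg; exists x.
have kerh x : in_kernel g (h x).
  by apply/eqP; rewrite -[g (h x)]/(hom_post g h x) gh.
have lf : linear ((fun x => Kernel (kerf x)) : A -> kernel g).
  by move=> r x y; apply: val_inj; rewrite /= linearP.
have lh : linear ((fun x => Kernel (kerh x)) : Q -> kernel g).
  by move=> r x y; apply: val_inj; rewrite /= linearP.
have [|k kE] := projQ _ _ (linear_of lf) (linear_of lh).
  move=> y; have [x xE] := (fg (val y)).1 (eqP (valP y)).
  by exists x; apply: val_inj.
by exists k; apply: homP => x; apply: (congr1 val (kE x)).
Qed.

Fact pure_linear (Q D : lmodType R) (q : Q) :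
  linear (pure q : D -> tensor Q D).
Proof. by move=> r x y; rewrite pureDr pureZr. Qed.
Definition pure_map (Q D : lmodType R) (q : Q) : {linear D -> tensor Q D} :=
  linear_of (@pure_linear Q D q).

Fact uncurry_bilinear (Q D A : lmodType R) (u : hom Q (hom D A)) :
  bilinear_map (fun q d => u q d).
Proof.
split=> *.
- by rewrite linearD.
- exact: linearD.
- by rewrite linearZ.
- exact: linearZ.
Qed.

Definition hom_uncurry (Q D A : lmodType R) (u : hom Q (hom D A)) :
    hom (tensor Q D) A :=
  linear_of (tensor_lift_linear (uncurry_bilinear u)).

Lemma hom_uncurry_pure (Q D A : lmodType R) (u : hom Q (hom D A)) q d :
  hom_uncurry u (pure q d) = u q d.
Proof. exact: tensor_lift_pure (uncurry_bilinear u) q d. Qed.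

Lemma hom_uncurry_inj (Q D A : lmodType R) : injective (@hom_uncurry Q D A).
Proof.
move=> u v uv; apply: homP => q; apply: homP => d.
by rewrite -!hom_uncurry_pure uv.
Qed.

Lemma hom_uncurry_surj (Q D A : lmodType R) (h : hom (tensor Q D) A) :
  exists u, hom_uncurry u = h.
Proof.
have lu : linear
    ((fun q => (h \o pure_map D q : {linear D -> A})) : Q -> hom D A).
  move=> r q q'; apply: homP => d /=.
  by rewrite pureDl pureZl linearP.
exists (linear_of lu : hom _ _); apply: homP; apply: tensor_ext => q d.
exact: hom_uncurry_pure.
Qed.

(** By adjunction [Hom(Q (x) D, -)] is [Hom(Q, Hom(D, -))]. *)
Lemma hom_tensor_exact (Q D A B E : lmodType R)
    (f : {linear A -> B}) (g : {linear B -> E}) :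
  projective Q ->
  exact_at (@hom_post R D _ _ f) (@hom_post R D _ _ g) ->
  exact_at (@hom_post R (tensor Q D) _ _ f)
           (@hom_post R (tensor Q D) _ _ g).
Proof.
move=> projQ fg.
have post_uncurry (X Y : lmodType R) (k : {linear X -> Y})
    (u : hom Q (hom D X)) :
  hom_post k (hom_uncurry u) =
  hom_uncurry (hom_post (hom_post k : {linear hom D X -> hom D Y}) u).
  apply: homP; apply: tensor_ext => q d.
  by rewrite [RHS]hom_uncurry_pure; apply: (congr1 k (hom_uncurry_pure u q d)).
apply: (exact_at_transport _ _ _ _ _ _ (projective_hom_exact projQ fg)).
- exact: hom_uncurry_surj.
- exact: hom_uncurry_surj.
- exact: hom_uncurry_inj.
- by apply: homP; apply: tensor_ext => q d; rewrite [LHS]hom_uncurry_pure.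
- exact: post_uncurry.
- exact: post_uncurry.
Qed.

Lemma iso_inv (M N : lmodType R) :
  isomorphic M N -> exists (i : {linear M -> N}) (j : {linear N -> M}),
    cancel i j /\ cancel j i.
Proof.
move=> [i [j ij ji]].
have lj : linear j.
  by move=> r x y; rewrite -[x in LHS]ji -[y in LHS]ji -linearP ij.
by exists i, (linear_of lj).
Qed.

Lemma hom_iso_exact (Y Y' A B E : lmodType R)
    (f : {linear A -> B}) (g : {linear B -> E}) :
  isomorphic Y' Y ->
  exact_at (@hom_post R Y _ _ f) (@hom_post R Y _ _ g) ->
  exact_at (@hom_post R Y' _ _ f) (@hom_post R Y' _ _ g).
Proof.
move=> /iso_inv[i [j [ij ji]]].
have surj (X : lmodType R) (h : hom Y' X) : exists k : hom Y X, hom_pre i k = h.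
  by exists (hom_pre j h); apply: homP => x /=; rewrite ij.
apply: (exact_at_transport (surj A) (surj B)
  (c := hom_pre i : hom Y E -> hom Y' E)); first 1 last.
- exact: linear0.
- by move=> h; apply: homP.
- by move=> h; apply: homP.
move=> h k hk; apply: homP => x; rewrite -[x]ji.
exact: (congr1 (fun u : hom Y' E => u (j x)) hk).
Qed.

Lemma projective_regular : projective (R^o : lmodType R).
Proof.
move=> A B g h surj_g; have [a ga] := surj_g (h 1).
have lk : linear ((fun r => r *: a) : R^o -> A).
  by move=> r s t; rewrite scalerDl scalerA.
exists (linear_of lk) => r /=; rewrite linearZ /= ga -linearZ /=.
by rewrite [_ *: _]mulr1.
Qed.

(** [C] is [R (x) C], and [R] is projective. *)
Lemma in_PC_self (C : lmodType R) : in_PC C C.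
Proof.
exists R^o; split; first exact: projective_regular.
exists (pure_map C (1 : R^o)).
have bil : bilinear_map ((fun r c => r *: c) : R^o -> C -> C).
  split=> *; rewrite ?scalerDl ?scalerDr ?scalerA //.
  by rewrite mulrC.
exists (tensor_lift ((fun r c => r *: c) : R^o -> C -> C)) => [c|].
  by rewrite [LHS](tensor_lift_pure bil) scale1r.
apply: (tensor_ext
  (f := pure_map C (1 : R^o) \o linear_of (tensor_lift_linear bil))
  (g := idfun)) => r c /=.
by rewrite (tensor_lift_pure bil) pureZr -pureZl [_ *: _]mulr1.
Qed.

End HomExactness.

(** * Base change of tensor products *)

Section BaseChangeTensor.
Variables (R S : comPzRingType) (phi : {rmorphism R -> S}).
Variables (P C : lmodType R).
Local Notation SP := (base_change phi P).
Local Notation SC := (base_change phi C).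

(** Curried, both maps are [S]-linear in each argument, so two uses of
    [base_change_ext] apply. *)
Lemma tensor_base_change_ext (K : lmodType S)
    (f g : {linear tensor SP SC -> K}) :
  (forall p c, f (pure (bpure phi 1 p) (bpure phi 1 c)) =
               g (pure (bpure phi 1 p) (bpure phi 1 c))) -> f =1 g.
Proof.
have [u uE] := hom_uncurry_surj (f : hom (tensor SP SC) K).
have [v vE] := hom_uncurry_surj (g : hom (tensor SP SC) K).
rewrite -uE -vE => uv.
suff -> : u = v by [].
apply: homP; apply: base_change_ext => p; apply: homP.
apply: base_change_ext => c.
by have := uv p c; rewrite !hom_uncurry_pure.
Qed.

(** This pairing, with values regarded as an [R]-module, induces the isomorphism
    of [base_change_tensor_iso]. *)
Definition pair_base_change (p : P) (c : C) : restrict (tensor SP SC) phi :=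
  pure (bpure phi 1 p) (bpure phi 1 c).

Fact pair_base_change_bilinear : bilinear_map pair_base_change.
Proof.
rewrite /pair_base_change; split=> [p q c|p c d|r p c|r p c].
- by rewrite bpureDr [LHS]pureDl.
- by rewrite bpureDr [LHS]pureDr.
- by rewrite bpureZr [LHS]pureZl.
- by rewrite bpureZr [LHS]pureZr.
Qed.
Definition pair_base_change_map :
    {linear tensor P C -> restrict (tensor SP SC) phi} :=
  linear_of (tensor_lift_linear pair_base_change_bilinear).

Fact pure_curry_linear : linear (pure_map C : P -> hom C (tensor P C)).
Proof. by move=> r p q; apply: homP => c /=; rewrite pureDl pureZl. Qed.
Definition pure_curry : {linear P -> hom C (tensor P C)} :=
  linear_of pure_curry_linear.

(** The inverse sends [(s (x) p) (x) (t (x) c)] to [st (x) (p (x) c)]. *)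
Lemma base_change_tensor_iso :
  isomorphic (base_change phi (tensor P C)) (tensor SP SC).
Proof.
pose a : {linear base_change phi (tensor P C) -> tensor SP SC} :=
  linear_of (base_change_lift_linear pair_base_change_map).
pose b : {linear tensor SP SC -> base_change phi (tensor P C)} :=
  hom_uncurry (linear_of (base_change_lift_linear
    (hom_to_base_change phi C (tensor P C) \o pure_curry
      : {linear P -> restrict (hom SC (base_change phi (tensor P C))) phi}))).
have aE p c : a (bpure phi 1 (pure p c)) =
    pure (bpure phi 1 p) (bpure phi 1 c).
  apply: (etrans (base_change_lift_bpure _ _ _)); rewrite scale1r.
  exact: (tensor_lift_pure pair_base_change_bilinear).
have bE p c : b (pure (bpure phi 1 p) (bpure phi 1 c)) =
    bpure phi 1 (pure p c).
  rewrite [LHS]hom_uncurry_pure /= base_change_lift_bpure hom_scaleE scale1r.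
  exact: base_change_map_bpure.
exists a; exists b.
  apply: (base_change_ext (f := b \o a) (g := idfun)).
  elim/tensor_ind => [|p c x IHx]; first by rewrite bpure0 !linear0.
  rewrite bpureDr [LHS]linearD IHx [RHS]linearD; congr (_ + _).
  exact: (etrans (congr1 b (aE p c))).
apply: (tensor_base_change_ext (f := a \o b) (g := idfun)) => p c.
by apply: (etrans (congr1 a (bE p c))).
Qed.

End BaseChangeTensor.

Lemma base_change_iso (R S : comPzRingType) (phi : {rmorphism R -> S})
    (M N : lmodType R) :
  isomorphic M N -> isomorphic (base_change phi M) (base_change phi N).
Proof.
move=> /iso_inv[i [j [ij ji]]].
exists (base_change_map phi i); exists (base_change_map phi j) => x.
  by rewrite /= (base_change_map_comp (h := idfun)) ?base_change_map_id.
by rewrite /= (base_change_map_comp (h := idfun)) ?base_change_map_id.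
Qed.

Lemma iso_trans (R : comPzRingType) (M N K : lmodType R) :
  isomorphic M N -> isomorphic N K -> isomorphic M K.
Proof. by move=> [i bi] [j bj]; exists (j \o i); apply: bij_comp. Qed.

Lemma in_PC_base_change (R S : comPzRingType) (phi : {rmorphism R -> S})
    (C X : lmodType R) :
  in_PC C X -> in_PC (base_change phi C) (base_change phi X).
Proof.
move=> [P [projP iX]]; exists (base_change phi P).
split; first exact: projective_base_change.
exact: iso_trans (base_change_iso phi iX) (base_change_tensor_iso phi P C).
Qed.

(** * Base change of proper resolutions *)

Lemma base_change_hom_exact (R S : comPzRingType) (phi : {rmorphism R -> S})
    (C A B D : lmodType R) (f : {linear A -> B}) (g : {linear B -> D}) :
  noetherian R -> finitely_generated C -> flat_morphism phi ->
  exact_at (@hom_post R C _ _ f) (@hom_post R C _ _ g) ->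
  exact_at (@hom_post S (base_change phi C) _ _ (base_change_map phi f))
           (@hom_post S (base_change phi C) _ _ (base_change_map phi g)).
Proof.
move=> noethR fgC flat_phi fg.
have bij N := base_change_hom_bij (phi := phi) N noethR fgC flat_phi.
apply: (exact_at_transport (bij A).2 (bij B).2 (bij D).1 _ _ _
  (flat_phi _ _ _ (hom_post f) (hom_post g) fg)).
- exact: linear0.
- by move=> w; rewrite -base_change_hom_post.
- by move=> w; rewrite -base_change_hom_post.
Qed.

Lemma PC_hom_base_change_exact (R S : comPzRingType) (phi : {rmorphism R -> S})
    (C A B D : lmodType R) (f : {linear A -> B}) (g : {linear B -> D})
    (Y : lmodType S) :
  noetherian R -> finitely_generated C -> flat_morphism phi ->
  in_PC (base_change phi C) Y ->
  exact_at (@hom_post R C _ _ f) (@hom_post R C _ _ g) ->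
  exact_at (@hom_post S Y _ _ (base_change_map phi f))
           (@hom_post S Y _ _ (base_change_map phi g)).
Proof.
move=> noethR fgC flat_phi [Q [projQ iY]] fg.
apply: hom_iso_exact iY _; apply: hom_tensor_exact projQ _.
exact: base_change_hom_exact.
Qed.

Theorem proposition2p4 (R S : comPzRingType) (phi : {rmorphism R -> S})
    (C M : lmodType R) (L : chain R) (eps : {linear L 0 -> M}) :
  noetherian R -> noetherian S ->
  semidualizing C ->
  flat_morphism phi ->
  proper_PC_resolution C L eps ->
  proper_PC_resolution (base_change phi C) (base_change_chain phi L)
    (base_change_map phi eps).
Proof.
move=> noethR _ [fgC _ _] flat_phi [PC_L complex_L exact_L]; split.
- by move=> n; apply: in_PC_base_change.
- case=> [|n] x /=.
  + rewrite (base_change_map_comp (h := zero_map _ _)) => [|y].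
      exact: base_change_map_zero.
    exact: (complex_L 0%N y).
  + rewrite (base_change_map_comp (h := zero_map _ _)) => [|y].
      exact: base_change_map_zero.
    exact: (complex_L n.+1 y).
- move=> Y PC_Y; have [surj_C exact_C] := exact_L C (in_PC_self C).
  split=> [y|[|n]].
  + have ex : exact_at (@hom_post R C _ _ eps)
        (@hom_post R C _ _ (zero_map M M)).
      by move=> h; split=> _; [exact: surj_C | apply: homP].
    have := PC_hom_base_change_exact noethR fgC flat_phi PC_Y ex.
    case/(_ y) => exY _; apply: exY; apply: homP => x.
    exact: base_change_map_zero.
  + exact: (PC_hom_base_change_exact noethR fgC flat_phi PC_Y (exact_C 0%N)).
  + exact: (PC_hom_base_change_exact noethR fgC flat_phi PC_Y (exact_C n.+1)).
Qed.
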